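(* There is a bijection between the set of staircase partitions $\lambda$ with $\ell(\lambda)\ge 3$ and the family $\mathcal{B}=\{\mathcal{G}_\sigma:\sigma\in\mathcal{Z}\}$ of graphs of reduced words of the permutations $\sigma\in\mathcal{Z}$.
   Context: A staircase partition is a partition of the form $\lambda=(\ell,\ell-1,\dots,2,1)$; $\ell(\lambda)=\ell$ is its number of parts. $\mathfrak{S}_r$ is the symmetric group on $\{1,\dots,r\}$ with simple transpositions $s_i=(i,i+1)$. $\mathcal{Z}$ is the set of permutations $\sigma\in\bigcup_{r\ge4}\mathfrak{S}_r$ whose one-line notation is $2,3,\dots,r-3,r,r-2,r-1,1$, one for each $r\ge4$ (for $r=4$ this is $4231$, for $r=5$ it is $25341$). A reduced word of $w$ is a sequence $a_1a_2\cdots a_m$ with $s_{a_1}\cdots s_{a_m}=w$ and $m=\ell(w)$, the number of inversions of $w$. The graph $\mathcal{G}_w$ has the reduced words of $w$ as vertices, two being joined by an edge if one is obtained from the other by a single braid relation (replacing consecutive letters $i\,(i+1)\,i$ by $(i+1)\,i\,(i+1)$ or vice versa) or a single commutation relation (replacing consecutive letters $i\,j$ by $j\,i$ with $|i-j|>1$). *)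

(* Defs.v *)
From HB Require Import structures.
From mathcomp Require Import all_boot all_fingroup.
From mathcomp Require Import boolp classical_sets functions.

Set Implicit Arguments.
Unset Strict Implicit.
Unset Printing Implicit Defensive.

Local Open Scope classical_set_scope.

(* Partitions are sequences of parts, so that [size la] is the number of parts. *)
Definition is_staircase (la : seq nat) : Prop := exists l, la = rev (iota 1 l).

Record sgraph (V : Type) := SGraph {
  vertices : set V;
  adj : V -> V -> Prop;
  adj_vertices : forall u v, adj u v -> vertices u /\ vertices v;
  adj_sym : forall u v, adj u v -> adj v u;
  adj_irrefl : forall u, ~ adj u u }.

Section SymmetricGroup.
Variable r : nat.

(* {1, ..., r} is encoded as 'I_r, the ordinal with value k standing for k + 1.
   The junk value 1 is taken when i is not in {1, ..., r - 1}. *)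
Definition simple_transp (i : nat) : 'S_r :=
  if (insub i.-1, insub i) is (Some x, Some y) then tperm x y else 1%g.

(* The product s_{a_1} ... s_{a_m} for composition of functions from right to
   left; in MathComp, [(s * t)%g] maps x to [t (s x)]. *)
Definition word_perm (a : seq nat) : 'S_r :=
  foldr (fun i p => (p * simple_transp i)%g) 1%g a.

Definition one_line (w : 'S_r) : seq nat :=
  [seq (w i : nat).+1 | i <- enum 'I_r].

Definition inversions (w : 'S_r) : nat :=
  #|[set p : 'I_r * 'I_r | (p.1 < p.2) && (w p.2 < w p.1)]%SET|.

Definition reduced_word (w : 'S_r) (a : seq nat) : Prop :=
  [/\ all (fun i => 0 < i < r) a, word_perm a = w & size a = inversions w].

End SymmetricGroup.

Definition braid_move (u v : seq nat) : Prop :=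
  exists x y i, u = x ++ [:: i; i.+1; i] ++ y /\
                v = x ++ [:: i.+1; i; i.+1] ++ y.

Definition commutation_move (u v : seq nat) : Prop :=
  exists x y i j, [/\ (i.+1 < j) || (j.+1 < i),
                      u = x ++ [:: i; j] ++ y & v = x ++ [:: j; i] ++ y].

Definition word_adj r (w : 'S_r) (u v : seq nat) : Prop :=
  [/\ reduced_word w u, reduced_word w v &
      [\/ braid_move u v, braid_move v u | commutation_move u v]].

Lemma word_adj_vertices r (w : 'S_r) u v :
  word_adj w u v -> reduced_word w u /\ reduced_word w v.
Proof. by case. Qed.

Lemma word_adj_sym r (w : 'S_r) u v : word_adj w u v -> word_adj w v u.
Proof.
case=> ru rv uv; split=> //; case: uv => [uv|vu|]; [exact: Or32|exact: Or31|].
by case=> x [y [i [j [ij -> ->]]]]; apply: Or33; exists x, y, j, i; rewrite orbC.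
Qed.

Lemma word_adj_irrefl r (w : 'S_r) u : ~ word_adj w u u.
Proof.
have braid_irrefl : ~ braid_move u u.
  case=> x [y [i [-> /eqP]]]; rewrite eqseq_cat// => /andP[_ /eqP[/eqP]].
  by rewrite ltn_eqF.
case=> _ _ [//|//|[x [y [i [j [ij -> /eqP]]]]]].
rewrite eqseq_cat// => /andP[_ /eqP[eij _]]; move: ij.
by rewrite eij orbb ltnNge leqnSn.
Qed.

Definition word_graph r (w : 'S_r) : sgraph (seq nat) :=
  SGraph (@word_adj_vertices r w) (@word_adj_sym r w) (@word_adj_irrefl r w).

(* The segment 2, 3, ..., r - 3 has r - 4 entries. *)
Definition Zfamily : set {r : nat & 'S_r} :=
  [set s | 4 <= tag s /\
     one_line (tagged s) =
       let r := tag s in iota 2 (r - 4) ++ [:: r; r - 2; r - 1; 1]].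

Definition Bfamily : set (sgraph (seq nat)) :=
  [set word_graph (tagged s) | s in Zfamily].

(* Main.v *)
Require Import Defs.
From mathcomp Require Import all_boot all_fingroup.
From mathcomp Require Import boolp classical_sets functions.
From mathcomp Require Import zify.

Local Open Scope classical_set_scope.

(** The staircase with l parts is sent to the graph of the permutation in
    S_(l+1).  The permutation in S_r is s_1 ... s_(r-1) s_(r-2) s_(r-3), and it
    has r + 1 inversions: each of the r - 1 pairs ending at the last position,
    and the two pairs formed by r with r - 2 and r - 1.  This word is therefore
    reduced, and since all vertices of the graph are words of length r + 1, the
    graph determines r. *)

Lemma simple_transpE r i (x : 'I_r) : 0 < i < r ->
  simple_transp r i x = (if x == i.-1 :> nat then i
                         else if x == i :> nat then i.-1 else x) :> nat.
Proof.
move=> /andP[i0 ir]; rewrite /simple_transp.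
have i1r : i.-1 < r by lia.
rewrite (insubT (fun k => k < r) i1r) (insubT (fun k => k < r) ir) /=.
case: tpermP => [->|->|/eqP + /eqP] /=; first by rewrite eqxx.
- by rewrite eqxx; case: eqP => //; lia.
- by rewrite -!val_eqE /= => /negbTE -> /negbTE ->.
Qed.

Lemma word_perm_cat r (a b : seq nat) :
  word_perm r (a ++ b) = (word_perm r b * word_perm r a)%g.
Proof. by elim: a => [|i a IH] /=; rewrite ?mulg1// IH mulgA. Qed.

(** The word spells a cycle. The last letter acts first, so the top point is carried down through
    all the factors, while every other point of the cycle meets a single factor that moves it, and
    goes up by one. *)
Lemma word_perm_iota r m n (x : 'I_r) : 0 < m -> m + n <= r ->
  word_perm r (iota m n) x =
    (if x == (m + n).-1 :> nat then m.-1
     else if m.-1 <= x < (m + n).-1 then x.+1 else x) :> nat.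
Proof.
elim: n m => [|n IH] m m0 mnr.
  by rewrite /= perm1 addn0; do !case: ifPn => //; lia.
rewrite /= permM simple_transpE; last lia.
by rewrite IH; do ?case: ifPn; lia.
Qed.

Lemma one_line_inj r : injective (@one_line r).
Proof.
move=> v w /eq_in_map vw; apply/permP => i; apply/val_inj.
by have [] := vw i (mem_enum _ _).
Qed.

Definition sigma_word r := iota 1 r.-1 ++ [:: r - 2; r - 3].
Definition sigma r : 'S_r := word_perm r (sigma_word r).

Lemma sigmaE n (x : 'I_n.+4) :
  sigma n.+4 x = (if x < n then x.+1 else if x == n :> nat then n.+3
                  else if x == n.+3 :> nat then 0 else x) :> nat.
Proof.
rewrite /sigma /sigma_word word_perm_cat permM word_perm_iota//.
(* The two trailing letters act before the long cycle. They send the values [n], [n.+1], [n.+2] to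
   [n.+2], [n], [n.+1]; the cycle then raises each by one, so that [n.+1] and [n.+2] end up
   fixed. *)
rewrite [word_perm _ _]/= mul1g permM !simple_transpE; try lia.
by do ?case: ifPn; lia.
Qed.

Lemma one_line_sigma n :
  one_line (sigma n.+4) = iota 2 n ++ [:: n.+4; n.+2; n.+3; 1].
Proof.
apply: (@eq_from_nth _ 0) => [|i].
  by rewrite size_map size_enum_ord size_cat size_iota/=; lia.
rewrite size_map size_enum_ord => ir.
rewrite (nth_map (Ordinal ir)) ?size_enum_ord// sigmaE nth_enum_ord//.
rewrite nth_cat size_iota; case: ltnP => ni; first by rewrite nth_iota.
(* Beyond the increasing segment only the four positions [n] to [n.+3] remain. *)
rewrite -(subnKC ni) in ir *; case: (i - n) ir => [|[|[|[|k]]]] kr;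
  by rewrite addKn /=; do ?case: ifPn; lia.
Qed.

Lemma inversions_sigma n : inversions (sigma n.+4) = n + 5.
Proof.
rewrite /inversions.
pose A := finset.setX [set~ ord_max : 'I_n.+4]%SET [set ord_max : 'I_n.+4]%SET.
pose B := finset.setX [set inord n : 'I_n.+4]%SET
                      [set (inord n.+1 : 'I_n.+4); inord n.+2]%SET.
have -> : [set p : 'I_n.+4 * 'I_n.+4 |
    (p.1 < p.2) && (sigma n.+4 p.2 < sigma n.+4 p.1)]%SET = (A :|: B)%SET.
  apply/setP => -[x y]; rewrite !inE/= !sigmaE -!val_eqE/= !inordK; try lia.
  have := ltn_ord x; have := ltn_ord y.
  by do ?case: ifPn; lia.
have AB0 : (A :&: B = finset.set0)%SET.
  by apply/setP => -[x y]; rewrite !inE/= -!val_eqE/= !inordK; lia.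
(* The disjoint sets [A] and [B] contribute [n + 3] and [2] pairs. *)
rewrite cardsU AB0 cards0 subn0 !cardsX cardsC1 !cards1 cards2.
by rewrite -val_eqE/= !inordK ?card_ord; lia.
Qed.

Lemma reduced_sigma_word n : reduced_word (sigma n.+4) (sigma_word n.+4).
Proof.
split=> //.
  rewrite /sigma_word all_cat /= andbT; apply/andP; split; last lia.
  by apply/allP => i; rewrite mem_iota; lia.
by rewrite inversions_sigma size_cat size_iota/=; lia.
Qed.

Lemma word_graph_sigma_inj m n :
  word_graph (sigma m.+4) = word_graph (sigma n.+4) -> m = n.
Proof.
move=> /(congr1 (@vertices _))/= mn.
(* An explicit vertex is needed, as empty vertex sets would not tell sizes apart. This one has
   length [m + 5], and as a vertex of the other graph it has length [n + 5]. *)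
have := reduced_sigma_word m; rewrite mn.
by case=> _ _; rewrite inversions_sigma size_cat size_iota/=; lia.
Qed.

Lemma Zfamily_sigma s : Zfamily s <-> exists n, s = existT _ n.+4 (sigma n.+4).
Proof.
split=> [|[n ->]]; last by split=> //=; rewrite one_line_sigma !subSS !subn0.
case: s => -[|[|[|[|n]]]] w [//= _ ws]; exists n; congr existT.
by apply: one_line_inj; rewrite one_line_sigma ws !subSS !subn0.
Qed.

Theorem proposition2p5 :
  exists f : seq nat -> sgraph (seq nat),
    set_bij [set la : seq nat | is_staircase la /\ 3 <= size la] Bfamily f.
Proof.
exists (fun la => word_graph (sigma (size la).+1)); split.
- move=> _ /= [[l ->]]; rewrite size_rev size_iota.
  case: l => [|[|[|n]]]// _.
  by exists (existT _ n.+4 (sigma n.+4)) => //; apply/Zfamily_sigma; exists n.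
- move=> _ _ /set_mem[[k ->] k3] /set_mem[[l ->] l3].
  move: k3 l3; rewrite !size_rev !size_iota.
  (* A staircase is determined by its number of parts, here [m.+3] and [n.+3]. *)
  by case: k l => [|[|[|m]]]// [|[|[|n]]]// _ _ /word_graph_sigma_inj->.
- move=> _ [_ /Zfamily_sigma[n ->] <-]; exists (rev (iota 1 n.+3)).
    by split; [exists n.+3|rewrite size_rev size_iota].
  by rewrite size_rev size_iota.
Qed.
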